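(* Let $q > 0$ be a composite number divisible by the prime $\hat p$, and let $n_q = q + \hat p$. Then $q \nmid n_q$, and nevertheless $$\binom{n_q - 1}{q - 1} \not\equiv 0 \pmod{q}.$$ *)

(* Defs.v *)
From mathcomp Require Import all_boot.

Set Implicit Arguments.
Unset Strict Implicit.
Unset Printing Implicit Defensive.

Definition composite (q : nat) : bool := (1 < q) && ~~ prime q.

(* Main.v *)
Require Import Defs.
From mathcomp Require Import all_boot.

(** The binomial coefficient is ['C(q + p - 1, p)] by symmetry, and absorption
    (the identity [absorb]) gives
    [p * 'C(q + p - 1, p) = q * 'C(q + p - 1, p - 1)].  If [q] divided
    the left-hand coefficient, then [p * q] would divide the right-hand side,
    so [p] would divide ['C(q + p - 1, p - 1)].  But the numerator of the latter
    is [(q + 1) ... (q + p - 1)], and none of these [p - 1] factors is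
    divisible by [p], since [p] divides [q] (lemma
    [prime_ndvd_bin_after_multiple]).

    That [q] does not divide [q + p] is where compositeness enters: otherwise
    [q] would divide [p], hence equal it. *)

(** The factors of the numerator [(q + 1) ... (q + p - 1)] lie strictly between
    the consecutive multiples [q] and [q + p] of [p], so Euclid's lemma leaves [p] nothing to divide. *)
Lemma prime_ndvd_bin_after_multiple p q :
  prime p -> p %| q -> ~~ (p %| 'C(q + p.-1, p.-1)).
Proof.
move=> p_pr p_q; apply/negP => p_bin.
have p_gt0 := prime_gt0 p_pr.
have : p %| (q + p.-1) ^_ p.-1 by rewrite -bin_ffact dvdn_mulr.
rewrite ffact_prod Euclid_dvd_prod //; rewrite big_has => /hasP[i _].
have i_lt := ltn_ord i.
rewrite -addnBA; last exact: ltnW.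
rewrite dvdn_addr // => /dvdn_leq.
rewrite subn_gt0 => /(_ i_lt); apply/negP; rewrite -ltnNge.
by apply: leq_ltn_trans (leq_subr _ _) _; rewrite prednK.
Qed.

Theorem theorem1p2 (q p n_q : nat) (q_gt0 : 0 < q) (q_comp : composite q)
    (p_prime : prime p) (p_dvd_q : p %| q) (n_qE : n_q = q + p) :
  ~~ (q %| n_q) /\ 'C(n_q - 1, q - 1) <> 0 %[mod q].
Proof.
have p_gt0 := prime_gt0 p_prime.
case/andP: q_comp => q_gt1 q_npr; rewrite {n_q}n_qE; split.
  rewrite dvdn_addr //; apply/negP => q_p; move: q_npr.
  have /eqP -> : q == p by rewrite eqn_dvd q_p.
  by rewrite p_prime.
have absorb : p * 'C(q + p - 1, q - 1) = q * 'C(q + p.-1, p.-1).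
  rewrite -bin_sub; last by rewrite leq_sub2r ?leq_addr.
  have -> : q + p - 1 - (q - 1) = p.-1.+1.
    by rewrite prednK // subnBA // subnK ?addn_gt0 ?q_gt0 // addKn.
  have -> : q + p - 1 = q + p.-1 by rewrite -addnBA // subn1.
  by rewrite -{1}(prednK p_gt0) mul_bin_left addnK.
move=> /eqP; rewrite mod0n -/(dvdn _ _) => q_bin.
have : q * p %| q * 'C(q + p.-1, p.-1) by rewrite -absorb mulnC dvdn_pmul2l.
by rewrite dvdn_pmul2l // (negbTE (prime_ndvd_bin_after_multiple _ _ _ _)).
Qed.
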